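(* There exist constants $C_1>0$ and $\kappa_1<0$ such that for any $\kappa<\kappa_1$ and $\alpha>\frac{C_1\log^2|\kappa|}{\kappa^2\Phi(\kappa)}$, there exist $0<\eta<\beta<1$, $c>0$ and $m\in\mathbb{N}$ such that for any $\mathcal I\subset[0,\pi/2]$ with $|\mathcal I|\le\exp(cN)$, $$\mathbb{P}\big[\mathcal S_\kappa(\beta,\eta,m,\alpha,\mathcal I)\neq\varnothing\big]=\exp(-\Theta(N)).$$
   Context: $\Phi$ is the standard normal CDF. Let $M,N\to\infty$ with $M/N\to\alpha$, and let $X_0,X_1,\dots,X_m$ be i.i.d. $M\times N$ matrices with i.i.d. ${\sf N}(0,1)$ entries. For $\tau\in[0,\pi/2]$ set $X_i(\tau)=\cos(\tau)X_0+\sin(\tau)X_i$. For $0<\eta<\beta<1$, $m\in\mathbb{N}$ and $\mathcal I\subset[0,\pi/2]$, $\mathcal S_\kappa(\beta,\eta,m,\alpha,\mathcal I)$ is the set of $m$-tuples $(\theta^{(1)},\dots,\theta^{(m)})$ with $\theta^{(i)}\in\{\pm1\}^N$ such that (i) $\beta-\eta<N^{-1}\langle\theta^{(i)},\theta^{(j)}\rangle<\beta$ for all $1\le i<j\le m$, and (ii) there exist $\tau_1,\dots,\tau_m\in\mathcal I$ with $X_i(\tau_i)\theta^{(i)}\ge\kappa\sqrt N\,\mathbf 1$ (entrywise) for all $1\le i\le m$. *)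

(* Defs.v *)
From HB Require Import structures.
From mathcomp Require Export all_boot all_order all_algebra finmap.
From mathcomp Require Export all_classical all_reals all_analysis.

Set Implicit Arguments.
Unset Strict Implicit.
Unset Printing Implicit Defensive.

Export Order.TTheory GRing.Theory Num.Theory numFieldNormedType.Exports.

Local Open Scope classical_set_scope.
Local Open Scope ring_scope.

(** Standard normal CDF; the second parameter of [normal_prob] is the standard
    deviation. *)
Definition Phi {R : realType} (x : R) : R :=
  fine (normal_prob (0 : R) 1 [set y | y <= x]).

Definition mutually_independent {R : realType} {d : measure_display}
    {T : measurableType d} (P : probability T R) {J : finType}
    (X : J -> {RV P >-> R}) : Prop :=
  forall (A : {set J}) (B : J -> set R), (forall j, measurable (B j)) ->
    P [set w | forall j, j \in A -> X j w \in B j] =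
    (\prod_(j in A) P [set w | X j w \in B j])%E.

Definition standard_normal {R : realType} {d : measure_display}
    {T : measurableType d} (P : probability T R) (X : {RV P >-> R}) : Prop :=
  forall B : set R, measurable B -> distribution P X B = normal_prob 0 1 B.

Definition iid_standard_normal {R : realType} {d : measure_display}
    {T : measurableType d} (P : probability T R) {J : finType}
    (X : J -> {RV P >-> R}) : Prop :=
  mutually_independent X /\ forall j, standard_normal (X j).

(** The realization at [w] of the random matrices [X_0, ..., X_m], all of whose
    entries are given as a single family indexed by (matrix, row, column). *)
Definition random_matrices {R : realType} {d : measure_display}
    {T : measurableType d} {P : probability T R} {m M N : nat}
    (X : 'I_m.+1 * 'I_M * 'I_N -> {RV P >-> R}) (w : T) (i : 'I_m.+1) :
    'M[R]_(M, N) :=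
  \matrix_(a < M, b < N) X (i, a, b) w.

(** [X_i(tau)], where the index [i : 'I_m] stands for the [i.+1]-st matrix,
    [lift ord0 i : 'I_m.+1]. *)
Definition interpolated {R : realType} {m M N : nat}
    (X : 'I_m.+1 -> 'M[R]_(M, N)) (tau : R) (i : 'I_m) : 'M[R]_(M, N) :=
  cos tau *: X ord0 + sin tau *: X (lift ord0 i).

Definition sign_vector {R : realType} {N : nat} (theta : 'cV[R]_N) : Prop :=
  forall b, theta b 0 = 1 \/ theta b 0 = -1.

Definition inner {R : realType} {N : nat} (u v : 'cV[R]_N) : R :=
  \sum_(b < N) u b 0 * v b 0.

(** The set [S_kappa(beta, eta, m, alpha, I)]; [alpha] enters only through the
    number [M] of rows. *)
Definition solution_tuples {R : realType} {m M N : nat} (kappa beta eta : R)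
    (I : set R) (X : 'I_m.+1 -> 'M[R]_(M, N)) : set ('I_m -> 'cV[R]_N) :=
  [set theta |
    (forall i, sign_vector (theta i)) /\
    (forall i j : 'I_m, (i < j)%N ->
       beta - eta < N%:R^-1 * inner (theta i) (theta j) < beta) /\
    (exists tau : 'I_m -> R, (forall i, I (tau i)) /\
       forall (i : 'I_m) (a : 'I_M),
         kappa * Num.sqrt N%:R <= (interpolated X (tau i) i *m theta i) a 0)].

(* Main.v *)
(** Upper bound: a first moment computation over the pairs (tuple of sign
    vectors, tuple of angles).  Put [K = |kappa|] and [l = ln K], and take overlaps
    at distance [delta = 16 l / K^2] from 1 and [m] of order [K^2 / l^2].  The
    admissible tuples number at most [exp (N (1 + 48 m l^2 / K^2))], and the angles
    cost [exp (c m N)] more.  For a fixed choice the rows are independent, and the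
    [m] margins of one row are standard Gaussians whose pairwise correlations are at
    most [1 - delta].  Two of them lie below [kappa] only if their sum, a Gaussian of
    variance at most [4 - 2 delta], lies below [2 kappa], which is rarer than
    [Phi kappa] by a power of [K]; so by Bonferroni a row fails with probability at
    least [m Phi(kappa) / 2], and [alpha N] rows beat the number of tuples.

    Lower bound: a single admissible tuple, with signs flipped on disjoint blocks of
    coordinates, and a single angle succeed with probability at least [1/2] per row,
    because [m Phi(kappa) <= 1/2]. *)
Require Import Defs.
From mathcomp Require Import measurable_realfun ring lra.

Set Implicit Arguments.
Unset Strict Implicit.
Unset Printing Implicit Defensive.

Local Open Scope classical_set_scope.
Local Open Scope ring_scope.

(** * Convolution of Gaussian laws *)

(** By uniqueness of Lebesgue measure: [|a|] times its pushforward under [x -> a * x + b] gives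
    every half-open interval its length. Packing that measure with its integral rule leaves only
    equality on measurable sets to be transferred later. *)
Lemma lebesgue_measure_affine (R : realType) (a b : R) :
  a != 0 ->
  {nu : {measure set (measurableTypeR R) -> \bar R} |
    (forall A, measurable A -> nu A = lebesgue_measure A) &
    forall f : R -> \bar R, measurable_fun setT f -> (forall x, (0 <= f x)%E) ->
      (\int[nu]_x f x = `|a|%:E * \int[lebesgue_measure]_x f (a * x + b)%R)%E}.
Proof.
move=> a0.
pose g : measurableTypeR R -> measurableTypeR R := fun x => a * x + b.
have mg : measurable_fun setT g by apply: measurable_funD => //; exact: measurable_funM.
pose mu' : {measure set (measurableTypeR R) -> \bar R} :=
  mscale (NngNum (normr_ge0 a)) (pushforward lebesgue_measure g).
exists (mu' mg); last first.
  move=> f mf f0; rewrite ge0_integral_mscale//=.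
  by rewrite ge0_integral_pushforward.
move=> A mA; symmetry; apply: lebesgue_measure_unique mA => _ [[u v]] _ <- /=.
have aN0 : `|a| != 0 by rewrite normr_eq0.
have [vu|uv] := leP v u.
  by rewrite set_itv_ge ?measure0// bnd_simp -leNgt.
rewrite /mu' /= /mscale /pushforward /=.
have [a_gt0|a_le0] := ltP 0 a.
  rewrite [X in (_ * lebesgue_measure X)%E](_ : _ =
    `](u - b) / a, (v - b) / a]%classic); last first.
    apply/seteqP; split=> x; rewrite /= /g !in_itv/= ler_pdivlMr// ltr_pdivrMr//;
    by rewrite ltrBlDr lerBrDr (mulrC x).
  rewrite !lebesgue_measure_itv/= !lte_fin uv ltr_pM2r ?invr_gt0// ltrD2r uv.
  by rewrite -!EFinB -EFinM gtr0_norm//; congr EFin; field.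
have {a_le0}a_lt0 : a < 0 by rewrite lt_neqAle a0.
rewrite [X in (_ * lebesgue_measure X)%E](_ : _ =
  `[(v - b) / a, (u - b) / a[%classic); last first.
  apply/seteqP; split=> x; rewrite /= /g !in_itv/= ler_ndivrMr// ltr_ndivlMr//;
  by rewrite ltrBlDr lerBrDr (mulrC x) andbC.
rewrite !lebesgue_measure_itv/= !lte_fin uv ltr_nM2r ?invr_lt0// ltrD2r uv.
by rewrite -!EFinB -EFinM ltr0_norm//; congr EFin; field.
Qed.

Lemma ge0_integral_affine (R : realType) (a b : R) (f : R -> \bar R) :
  a != 0 -> measurable_fun setT f -> (forall x, (0 <= f x)%E) ->
  (\int[lebesgue_measure]_x f x =
   `|a|%:E * \int[lebesgue_measure]_x f (a * x + b)%R)%E.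
Proof.
move=> a0 mf f0; have [nu nuE <-//] := @lebesgue_measure_affine R a b a0.
by apply: eq_measure_integral => A mA _; rewrite nuE.
Qed.

Lemma measurable_indic_affine (R : realType) (B : set R) (a b : R) :
  measurable B -> measurable_fun setT (fun x : R => \1_B (a * x + b) : R).
Proof.
move=> mB; have mf : measurable_fun setT (fun x : R => a * x + b).
  by apply: measurable_funD => //; exact: measurable_funM.
by have := measurableT_comp (@measurable_indic _ _ R setT B mB) mf.
Qed.

Lemma measurable_normal_pdf_affine (R : realType) (m s a b : R) :
  measurable_fun setT (fun x : R => normal_pdf m s (a * x + b)).
Proof.
have mf : measurable_fun setT (fun x : R => a * x + b).
  by apply: measurable_funD => //; exact: measurable_funM.
exact: (measurableT_comp (measurable_normal_pdf m s) mf).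
Qed.

Lemma measurable_normal_pdfE (R : realType) (m s : R) :
  measurable_fun setT (fun x : R => (normal_pdf m s x)%:E).
Proof. by apply/measurable_EFinP; exact: measurable_normal_pdf. Qed.

(** The Gaussian density and the Radon-Nikodym derivative have equal integrals over all measurable
    sets, hence agree almost everywhere. *)
Lemma ge0_integral_normal_prob (R : realType) (m s : R) (f : R -> \bar R) :
  measurable_fun setT f -> (forall x, (0 <= f x)%E) ->
  (\int[normal_prob m s]_x f x =
   \int[lebesgue_measure]_x (f x * (normal_pdf m s x)%:E))%E.
Proof.
move=> mf f0.
rewrite -(Radon_Nikodym_SigmaFinite.change_of_variables (@normal_prob_dominates R m s))//.
have RNi := Radon_Nikodym_SigmaFinite.f_integrable (@normal_prob_dominates R m s).
apply: ae_eq_integral => //.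
- by apply: emeasurable_funM => //; exact: measurable_int RNi.
- by apply: emeasurable_funM => //; exact: measurable_normal_pdfE.
apply: ae_eqe_mul2l; apply: integral_ae_eq => //.
  exact: measurable_normal_pdfE.
move=> E _ mE; rewrite -Radon_Nikodym_SigmaFinite.f_integral//.
exact: normal_prob_dominates.
Qed.

Lemma normal_prob_indic (R : realType) (m s : R) (B : set R) :
  (normal_prob m s B =
   \int[lebesgue_measure]_x (\1_B x * normal_pdf m s x)%:E)%E.
Proof.
rewrite /normal_prob integral_mkcond; apply: eq_integral => x _.
by rewrite /patch indicE; case: (x \in B); rewrite ?mul1r ?mul0r.
Qed.

Lemma normal_prob_scale (R : realType) (a s : R) (B : set R) :
  a != 0 -> s != 0 -> measurable B ->
  normal_prob 0 s [set x | B (a * x)] = normal_prob 0 (`|a| * s) B.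
Proof.
move=> a0 s0 mB; rewrite !normal_prob_indic.
rewrite [RHS](@ge0_integral_affine R a 0)//; last 2 first.
- apply/measurable_EFinP/measurable_funM => //; exact: measurable_normal_pdf.
- by move=> x; rewrite lee_fin mulr_ge0// normal_pdf_ge0.
rewrite -ge0_integralZl//; last 2 first.
- apply/measurable_EFinP/measurable_funM.
    exact: measurable_indic_affine.
  exact: measurable_normal_pdf_affine.
- by move=> x _; rewrite lee_fin mulr_ge0// normal_pdf_ge0.
apply: eq_integral => x _; rewrite addr0 !indicE.
have -> : (x \in [set x | B (a * x)]) = (a * x \in B) by apply/idP/idP; rewrite !inE.
rewrite -EFinM mulrCA; congr (_ * _)%:E.
have as0 : `|a| * s != 0 by rewrite mulf_neq0// normr_eq0.
rewrite !normal_pdfE// /normal_peak /normal_fun.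
have -> : (`|a| * s) ^+ 2 * pi *+ 2 = `|a| ^+ 2 * (s ^+ 2 * pi *+ 2) by ring.
rewrite sqrtrM ?sqr_ge0// sqrtr_sqr normr_id invfM mulrA mulrA divff ?normr_eq0// mul1r.
congr (_ * expR _).
rewrite !subr0 !exprMn real_normK ?num_real//; field.
by rewrite s0 a0.
Qed.

(* Completing the square: the product of the two densities is the density of the
   sum times the density of the conditional law of [x] given the sum [z]. *)
Lemma normal_pdf_conv (R : realType) (s t x z : R) : s != 0 -> t != 0 ->
  normal_pdf 0 s x * normal_pdf 0 t (z - x) =
  normal_pdf 0 (Num.sqrt (s ^+ 2 + t ^+ 2)) z *
  normal_pdf (z * s ^+ 2 / (s ^+ 2 + t ^+ 2))
    (s * t / Num.sqrt (s ^+ 2 + t ^+ 2)) x.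
Proof.
move=> s0 t0.
have s2 : 0 < s ^+ 2 by rewrite exprn_even_gt0.
have t2 : 0 < t ^+ 2 by rewrite exprn_even_gt0.
have u2 : 0 < s ^+ 2 + t ^+ 2 by rewrite addr_gt0.
have u0 : 0 < Num.sqrt (s ^+ 2 + t ^+ 2) by rewrite sqrtr_gt0.
have w0 : s * t / Num.sqrt (s ^+ 2 + t ^+ 2) != 0.
  by rewrite !mulf_neq0// invr_eq0 gt_eqF.
rewrite !normal_pdfE// ?gt_eqF// mulrACA [RHS]mulrACA; congr (_ * _).
  rewrite /normal_peak -!invfM; congr (_^-1); rewrite -!sqrtrM.
  - congr Num.sqrt; rewrite exprMn exprVn sqr_sqrtr ?ltW//; field.
    by rewrite gt_eqF.
  - by rewrite pmulrn_lge0// mulr_ge0 ?sqr_ge0 ?pi_ge0.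
  - by rewrite pmulrn_lge0// mulr_ge0 ?sqr_ge0 ?pi_ge0.
rewrite /normal_fun -!expRD; congr expR.
rewrite sqr_sqrtr ?ltW// exprMn exprVn sqr_sqrtr ?ltW//; field.
by rewrite s0 t0 gt_eqF.
Qed.

Lemma normal_prob_conv (R : realType) (s t : R) (B : set R) :
  s != 0 -> t != 0 -> measurable B ->
  (normal_prob 0 s \x normal_prob 0 t)%E [set p | B (p.1 + p.2)] =
  normal_prob 0 (Num.sqrt (s ^+ 2 + t ^+ 2)) B.
Proof.
move=> s0 t0 mB.
set u := Num.sqrt (s ^+ 2 + t ^+ 2).
have mB' : measurable [set p : R * R | B (p.1 + p.2)].
  rewrite -[X in measurable X]setTI.
  by apply: (_ : measurable_fun setT (fun p : R * R => p.1 + p.2)) => //; exact: measurable_funD.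
(* Joint density of the first summand [x] and the sum [z], restricted to [z] in [B]. Integrating [z]
   first gives the product measure; integrating [x] first leaves the density of the sum, since the
   conditional density of [x] has mass 1. *)
pose F (p : R * R) := (\1_B p.2 * (normal_pdf 0 s p.1 * normal_pdf 0 t (p.2 - p.1)))%:E.
have F0 p : (0 <= F p)%E by rewrite lee_fin !mulr_ge0// normal_pdf_ge0.
have mF : measurable_fun setT F.
  apply/measurable_EFinP/measurable_funM; first exact: measurableT_comp.
  apply: measurable_funM.
    by apply: measurableT_comp => //; exact: measurable_normal_pdf.
  apply: (measurableT_comp (f := normal_pdf 0 t)); first exact: measurable_normal_pdf.
  exact: measurable_funB.
transitivity (\int[lebesgue_measure]_x \int[lebesgue_measure]_z F (x, z))%E.
  rewrite /product_measure1 ge0_integral_normal_prob//; last exact: measurable_fun_xsection.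
  apply: eq_integral => x _ /=.
  rewrite normal_prob_indic.
  rewrite (@ge0_integral_affine R 1 (- x))//; last 2 first.
  - apply/measurable_EFinP/measurable_funM; last exact: measurable_normal_pdf.
    by apply: measurable_indic; exact: measurable_xsection.
  - by move=> y; rewrite lee_fin mulr_ge0// normal_pdf_ge0.
  rewrite normr1 mul1e -ge0_integralZr//; last 2 first.
  - by move=> y _; rewrite lee_fin mulr_ge0// normal_pdf_ge0.
  - by rewrite lee_fin normal_pdf_ge0.
  - apply: eq_integral => z _; rewrite /F /= -EFinM mul1r.
    have -> : \1_(xsection [set p | B (p.1 + p.2)] x) (z - x) = \1_B z :> R.
      rewrite !indicE; congr (_%:R); congr nat_of_bool.
      by apply/idP/idP; rewrite mem_xsection !inE/= addrC subrK.
    by congr EFin; ring.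
  apply/measurable_EFinP/measurable_funM.
    by apply: measurable_indic_affine; exact: measurable_xsection.
  exact: measurable_normal_pdf_affine.
transitivity (\int[lebesgue_measure]_z \int[lebesgue_measure]_x F (x, z))%E.
  exact: (@fubini_tonelli _ _ _ _ R lebesgue_measure lebesgue_measure F mF F0).
rewrite normal_prob_indic.
apply: eq_integral => z _.
under eq_integral do rewrite /F /= normal_pdf_conv// mulrA EFinM.
rewrite ge0_integralZl//; last 3 first.
- exact: measurable_normal_pdfE.
- by move=> x _; rewrite lee_fin normal_pdf_ge0.
- by rewrite lee_fin mulr_ge0// normal_pdf_ge0.
by rewrite integral_normal_pdf mule1.
Qed.

(** * Independence of disjoint groups of variables *)

(** Both sides are finite measures in [A]: a restriction of [P] and a multiple of [P]. They agree on
    the pi-system [G], hence on what it generates. *)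
Lemma pi_lambda_indep (R : realType) (d : measure_display) (T : measurableType d)
    (P : probability T R) (G : set (set T)) (E : set T) :
  G `<=` measurable -> setI_closed G -> G setT -> measurable E ->
  (forall A, G A -> P (A `&` E) = P A * P E)%E ->
  forall A, <<s G >> A -> (P (A `&` E) = P A * P E)%E.
Proof.
move=> Gm GI GT mE GE A sA.
pose m1 := mrestr P mE.
pose m2 := mscale (NngNum (fine_ge0 (measure_ge0 P E))) P.
have m2E B : m2 B = (P B * P E)%E.
  by rewrite /m2 /mscale /= fineK ?fin_num_measure// muleC.
rewrite -m2E -[LHS]/(m1 A).
apply: (g_sigma_algebra_measure_unique G Gm (fun=> setT)) => //.
- by rewrite bigcup_const//; exists 0%N.
- by move=> B GB; rewrite [RHS]m2E -GE.
- by move=> _; rewrite /= /mrestr setTI ltey_eq fin_num_measure.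
Qed.

Section independence.
Context {R : realType} {d : measure_display} {T : measurableType d}
  {P : probability T R} {J : finType}.
Variable X : J -> {RV P >-> R}.

(** A pi-system generating the sigma-algebra of the variables [X j] with [j] in [A]. *)
Definition cylinders (A : {set J}) : set (set T) :=
  [set E | exists B : J -> set R, (forall j, measurable (B j)) /\
     E = [set w | forall j, j \in A -> X j w \in B j]].

Lemma cylindersS (A1 A2 : {set J}) : A1 \subset A2 ->
  cylinders A1 `<=` cylinders A2.
Proof.
move=> /fintype.subsetP A12 _ [B [mB ->]].
exists (fun j => if j \in A1 then B j else setT); split=> [j|]; first by case: ifP.
apply/seteqP; split=> w /= Bw j jA.
  by case: ifPn => [/Bw//|_]; rewrite inE.
by have := Bw j (A12 _ jA); rewrite jA.
Qed.

Lemma cylinders_measurable A : cylinders A `<=` measurable.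
Proof.
move=> _ [B [mB ->]].
have -> : [set w | forall j, j \in A -> X j w \in B j] =
    \bigcap_(j in [set j | j \in A]) (X j @^-1` B j).
  by apply/seteqP; split=> w /= Bw j /Bw; rewrite inE.
apply: fin_bigcap_measurable => // j _.
by rewrite -[Y in measurable Y]setTI; exact: measurable_funP.
Qed.

Lemma cylindersI A : setI_closed (cylinders A).
Proof.
move=> _ _ [B [mB ->]] [C [mC ->]]; exists (fun j => B j `&` C j); split.
  by move=> j; exact: measurableI.
apply/seteqP; split=> w /=.
  by move=> [Bw Cw] j jA; rewrite in_setI Bw// Cw.
by move=> BC; split=> j /BC; rewrite in_setI => /andP[].
Qed.

Lemma cylindersT A : cylinders A setT.
Proof.
by exists (fun=> setT); split => //; apply/seteqP; split=> w //= _ j _; rewrite inE.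
Qed.

Lemma sigma_cylinders_measurable A : <<s cylinders A >> `<=` measurable.
Proof.
exact: (smallest_sub (@sigma_algebra_measurable _ T) (@cylinders_measurable A)).
Qed.

Lemma sigma_cylindersS (A1 A2 : {set J}) : A1 \subset A2 ->
  <<s cylinders A1 >> `<=` <<s cylinders A2 >>.
Proof.
move=> A12; apply: smallest_sub; first exact: smallest_sigma_algebra.
by move=> E /(@cylindersS _ _ A12); exact: sub_sigma_algebra.
Qed.

Lemma sigma_cylindersI A E1 E2 : <<s cylinders A >> E1 -> <<s cylinders A >> E2 ->
  <<s cylinders A >> (E1 `&` E2).
Proof. exact: (@measurableI _ (g_sigma_algebraType (cylinders A))). Qed.

Lemma sigma_cylinders_sum (A : {set J}) (a : J -> R) (B : set R) :
  measurable B -> <<s cylinders A >> [set w | B (\sum_(j in A) a j * X j w)].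
Proof.
move=> mB.
(* With the generated sigma-algebra as the structure on [T], the usual closure rules for measurable
   functions apply. *)
pose TA : measurableType _ := g_sigma_algebraType (cylinders A).
have mX j : j \in A -> measurable_fun setT (X j : TA -> R).
  move=> jA _ C mC; rewrite setTI; apply: sub_sigma_algebra.
  exists (fun i => if i == j then C else setT); split=> [i|]; first by case: ifP.
  apply/seteqP; split=> w /=.
    by move=> Cw i _; case: eqP => [->|_]; rewrite inE.
  by move=> /(_ _ jA); rewrite eqxx inE.
suff mS : measurable_fun setT (fun w : TA => \sum_(j in A) a j * X j w).
  by have := mS measurableT _ mB; rewrite setTI.
under eq_fun do rewrite big_mkcond.
apply: measurable_sum => j; case: (boolP (j \in A)) => // jA.
by apply: measurable_funM => //; exact: mX.
Qed.

Hypothesis indX : mutually_independent X.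

(** The pi-lambda argument is applied once to each factor; on two cylinders over disjoint index sets
    the claim is mutual independence on the union. *)
Lemma sigma_cylinders_indep (A1 A2 : {set J}) (E1 E2 : set T) :
  (forall j, j \in A1 -> j \notin A2) ->
  <<s cylinders A1 >> E1 -> <<s cylinders A2 >> E2 ->
  (P (E1 `&` E2) = P E1 * P E2)%E.
Proof.
move=> A12 sE1 sE2.
have mE2 := sigma_cylinders_measurable sE2.
apply: (pi_lambda_indep _ _ _ _ _ sE1) => //; [exact: cylinders_measurable|exact: cylindersI
  |exact: cylindersT|].
move=> {sE1}{}E1 cE1; have mE1 := cylinders_measurable cE1.
rewrite setIC muleC.
apply: (pi_lambda_indep _ _ _ _ _ sE2) => //; [exact: cylinders_measurable
  |exact: cylindersI|exact: cylindersT|].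
move=> _ [B2 [mB2 ->]]; move: cE1 => [B1 [mB1 ->]] {mE1 mE2 sE2 E2 E1}.
pose B j := if j \in A1 then B1 j else B2 j.
have mB j : measurable (B j) by rewrite /B; case: ifP.
have -> : [set w | forall j, j \in A2 -> X j w \in B2 j] `&`
   [set w | forall j, j \in A1 -> X j w \in B1 j] =
   [set w | forall j, j \in A1 :|: A2 -> X j w \in B j].
  apply/seteqP; split=> w /=.
    move=> [w2 w1] j; rewrite finset.in_setU /B; case: ifPn => [jA1 _|_ /= jA2];
    [exact: w1|exact: w2].
  move=> wB; split=> j jA; have := wB j; rewrite finset.in_setU jA ?orbT /B => /(_ isT).
    by case: ifPn => // /A12; rewrite jA.
  by rewrite jA.
rewrite !indX// (eq_bigl [predU A1 & A2]); last by move=> j; rewrite finset.in_setU.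
rewrite bigU//=; last first.
  by rewrite disjoint_subset; apply/fintype.subsetP => j /A12.
rewrite muleC; congr (_ * _)%E; apply: eq_bigr => j jA; rewrite /B ?jA//.
by case: ifPn => // /A12; rewrite jA.
Qed.

(** The fibres of [rho] are disjoint groups of variables, so they can be split off one at a time. *)
Lemma sigma_cylinders_prod (K : finType) (rho : J -> K) (E : K -> set T) :
  (forall k, <<s cylinders [set j | rho j == k]%SET >> (E k)) ->
  P [set w | forall k, E k w] = (\prod_k P (E k))%E.
Proof.
move=> sE.
suff H (s : seq K) : uniq s ->
    <<s cylinders [set j | rho j \in s]%SET >> [set w | forall k, k \in s -> E k w] /\
    P [set w | forall k, k \in s -> E k w] = (\prod_(k <- s) P (E k))%E.
  rewrite -(H _ (index_enum_uniq K)).2; congr (P _).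
  apply/seteqP; split=> w /= Ew k; first by move=> _; exact: Ew.
  by apply: Ew; rewrite mem_index_enum.
elim: s => [_|k s IHs /= /andP[ks us]].
  rewrite big_nil.
  have -> : [set w | forall k, k \in [::] -> E k w] = setT by apply/seteqP; split.
  by split; [apply: sub_sigma_algebra; exact: cylindersT|exact: probability_setT].
have [sEs PEs] := IHs us.
have -> : [set w | forall l, l \in k :: s -> E l w] =
    E k `&` [set w | forall l, l \in s -> E l w].
  apply/seteqP; split=> w /=.
    by move=> Ew; split=> [|l ls]; apply: Ew; rewrite inE ?eqxx// ls orbT.
  by move=> [Ek Es] l; rewrite inE => /predU1P[->//|]; exact: Es.
split.
  apply: sigma_cylindersI; [move: (sE k)|move: sEs]; apply: sigma_cylindersS;
    apply/fintype.subsetP => j; rewrite !inE; first by move=> ->.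
  by move=> ->; rewrite orbT.
rewrite big_cons -PEs; apply: (sigma_cylinders_indep _ (sE k) sEs).
by move=> j; rewrite !inE => /eqP ->.
Qed.

End independence.

Lemma measurable_lincomb (R : realType) (d : measure_display) (T : measurableType d)
    (P : probability T R) (J : finType) (X : J -> {RV P >-> R})
    (A : {set J}) (a : J -> R) :
  measurable_fun setT (fun w => \sum_(j in A) a j * X j w).
Proof.
under eq_fun do rewrite big_mkcond.
by apply: measurable_sum => j; case: (j \in A) => //; exact: measurable_funM.
Qed.

(** Induction on the number of terms: one term is split off, is independent of the rest, and the two
    laws are convolved. Zero coefficients and a rest of zero variance are treated apart, since the
    convolution rule wants nonzero deviations. *)
Lemma normal_lincomb (R : realType) (d : measure_display) (T : measurableType d)
    (P : probability T R) (J : finType) (X : J -> {RV P >-> R})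
    (A : {set J}) (a : J -> R) (B : set R) :
  iid_standard_normal X -> measurable B -> 0 < \sum_(j in A) a j ^+ 2 ->
  P [set w | B (\sum_(j in A) a j * X j w)] =
  normal_prob 0 (Num.sqrt (\sum_(j in A) a j ^+ 2)) B.
Proof.
move=> [indX norX].
have distE k C : measurable C -> P [set w | C (X k w)] = normal_prob 0 1 C.
  by move=> mC; rewrite -(norX k).
have [n] := ubnP #|A|; elim: n => // n IHn in A B * => An mB sA_gt0.
have [A0|[k kA]] := set_0Vmem A.
  by move: sA_gt0; rewrite big1 ?ltxx// => j; rewrite A0 inE.
have sumD (F : J -> R) :
    \sum_(j in A) F j = F k + \sum_(j in (A :\ k)%SET) F j.
  by rewrite (big_setD1 k).
have AkA : (#|A :\ k| < n)%N by rewrite (cardsD1 k) kA in An.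
have eqP_set (F G : T -> R) : F =1 G -> P [set w | B (F w)] = P [set w | B (G w)].
  by move=> FG; congr (P _); apply/seteqP; split=> w /=; rewrite FG.
have [ak0|ak0] := eqVneq (a k) 0.
  rewrite (eqP_set _ (fun w => \sum_(j in (A :\ k)%SET) a j * X j w)); last first.
    by move=> w; rewrite sumD ak0 mul0r add0r.
  move: sA_gt0; rewrite !sumD ak0 expr0n/= add0r => sA_gt0.
  exact: IHn.
have ak_gt0 : 0 < `|a k| by rewrite normr_gt0.
have distk C : measurable C -> P [set w | C (a k * X k w)] = normal_prob 0 `|a k| C.
  move=> mC; rewrite -[ `|a k| ]mulr1 -normal_prob_scale//.
  rewrite -(distE k [set x | C (a k * x)])// -[X in measurable X]setTI.
  by apply: (_ : measurable_fun setT (fun x : R => a k * x)) => //; exact: measurable_funM.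
set s := \sum_(j in (A :\ k)%SET) a j ^+ 2.
have s_ge0 : 0 <= s by apply: sumr_ge0 => j _; exact: sqr_ge0.
rewrite (sumD (fun j => a j ^+ 2)) -/s.
have [s0|s_neq0] := eqVneq s 0.
  rewrite s0 addr0 sqrtr_sqr -distk//.
  apply: eqP_set => w; rewrite sumD big1 ?addr0// => j jA.
  have /eqP := s0.
  rewrite psumr_eq0 => [/allP/(_ j (mem_index_enum j))|i _]; last exact: sqr_ge0.
  by rewrite jA/= sqrf_eq0 => /eqP ->; rewrite mul0r.
have s_gt0 : 0 < s by rewrite lt_neqAle eq_sym s_neq0.
pose U w := \sum_(j in (A :\ k)%SET) a j * X j w.
pose V w := a k * X k w.
have mU : measurable_fun setT U by exact: measurable_lincomb.
have mV : measurable_fun setT V by exact: measurable_funM.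
pose UV w : measurableTypeR R * measurableTypeR R := (U w, V w).
have mUV : measurable_fun setT UV by exact/measurable_fun_pair.
have sum1 F : \sum_(j in [set k]%SET) F j = F k :> R by rewrite big_set1.
pose muUV := (pushforward P UV :
  {measure set (measurableTypeR R * measurableTypeR R) -> \bar R}).
(* The law of the pair is the product law because the two agree on rectangles, by independence. *)
have joint := @product_measure_unique _ _ _ _ R (normal_prob 0 (Num.sqrt s))
  (normal_prob 0 `|a k|) (muUV mUV).
have sumr2 : a k ^+ 2 + s = Num.sqrt s ^+ 2 + `|a k| ^+ 2.
  by rewrite sqr_sqrtr// real_normK ?num_real// addrC.
rewrite sumr2 -normal_prob_conv ?gt_eqF ?sqrtr_gt0//.
rewrite joint.
- rewrite /muUV/= /pushforward /=; apply: eqP_set => w; rewrite sumD addrC//.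
- move=> B1 B2 mB1 mB2; transitivity
    (P [set w | B1 (U w)] * P [set w | B2 (V w)])%E; last first.
    by rewrite IHn// distk.
  apply: (sigma_cylinders_indep indX (A1 := (A :\ k)%SET) (A2 := [set k]%SET)
    (E1 := [set w | B1 (U w)]) (E2 := [set w | B2 (V w)])).
  + by move=> j; rewrite !inE => /andP[].
  + exact: sigma_cylinders_sum.
  + have -> : [set w | B2 (V w)] =
        [set w | B2 (\sum_(j in [set k]%SET) a j * X j w)].
      by apply/seteqP; split=> w /=; rewrite sum1.
    exact: sigma_cylinders_sum.
- rewrite -[X in measurable X]setTI.
  by apply: (_ : measurable_fun setT (fun p : R * R => p.1 + p.2)) => //; exact: measurable_funD.
Qed.

(** * Gaussian tails and the Bonferroni inequality *)

Lemma measurable_lt_set (R : realType) (x : R) : measurable [set y : R | y < x].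
Proof. by rewrite -set_itvE. Qed.

Lemma measurable_le_set (R : realType) (x : R) : measurable [set y : R | y <= x].
Proof. by rewrite -set_itvE. Qed.

(** [Phi] uses a closed half-line, failures of a margin an open one; the endpoint is a null set. *)
Lemma normal_prob_lt (R : realType) (x : R) :
  normal_prob 0 1 [set y | y < x] = (Phi x)%:E.
Proof.
have mlt := @measurable_lt_set R x.
rewrite /Phi fineK; last by rewrite fin_num_measure//; exact: measurable_le_set.
have -> : [set y | y <= x] = [set y | y < x] `|` [set x].
  apply/seteqP; split=> y /=; first by rewrite le_eqVlt => /predU1P[->|]; [right|left].
  by move=> [/ltW//|->].
rewrite measureU//; last first.
  by apply/seteqP; split=> y //= [+ yx]; rewrite yx ltxx.
have /null_content_dominatesP/(_ [set x]) dom0 := @normal_prob_dominates R 0 1.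
rewrite [X in (_ + X)%E](_ : _ = 0%E) ?adde0//; apply: dom0 => //.
exact: lebesgue_measure_set1.
Qed.

(** For [y < x <= 0] one has [x^2 + (y - x)^2 <= y^2], so the density at [y] is at most the claimed
    bound times the density centred at [x]. *)
Lemma normal_prob_tail (R : realType) (s x : R) : s != 0 -> x <= 0 ->
  (normal_prob 0%R s [set y | (y < x)%R] <= (expR (- (x ^+ 2 / (s ^+ 2 *+ 2)))%R)%:E)%E.
Proof.
move=> s0 x0; rewrite normal_prob_indic.
have s2 : 0 < s ^+ 2 by rewrite exprn_even_gt0.
apply: (@le_trans _ _ (\int[lebesgue_measure]_y
    ((expR (- (x ^+ 2 / (s ^+ 2 *+ 2)))%R)%:E * (normal_pdf x s y)%:E))%E); last first.
  rewrite ge0_integralZl//; last 2 first.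
  - exact: measurable_normal_pdfE.
  - by move=> y _; rewrite lee_fin normal_pdf_ge0.
  by rewrite integral_normal_pdf mule1.
apply: ge0_le_integral => //.
- by move=> y _; rewrite lee_fin mulr_ge0// normal_pdf_ge0.
- apply/measurable_EFinP/measurable_funM; last exact: measurable_normal_pdf.
  by apply: measurable_indic; exact: measurable_lt_set.
- by apply: emeasurable_funM => //; exact: measurable_normal_pdfE.
move=> y _; rewrite -EFinM lee_fin indicE.
case: (boolP (y \in _)) => [|_]; last first.
  by rewrite mul0r mulr_ge0 ?expR_ge0// normal_pdf_ge0.
rewrite inE/= => yx; rewrite mul1r !normal_pdfE// mulrCA ler_wpM2l//.
  exact: normal_peak_ge0.
rewrite /normal_fun -expRD ler_expR !mulNr -opprD lerN2 -mulrDl.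
rewrite ler_pM2r; last by rewrite invr_gt0 pmulrn_lgt0.
nra.
Qed.

Lemma Phi_tail (R : realType) (x : R) : x <= 0 -> Phi x <= expR (- (x ^+ 2 / 2)).
Proof.
move=> x0; rewrite -lee_fin -normal_prob_lt.
have := normal_prob_tail (oner_neq0 R) x0.
by rewrite expr1n.
Qed.

(** Only the interval of length [1 / |x|] to the left of [x] is kept. There [z^2 <= x^2 + 3], which
    costs [exp (- 3 / 2) >= 1 / 9], and the peak of the density is at least [1 / 3]; hence 27. *)
Lemma Phi_lower (R : realType) (x : R) : x <= - 1 ->
  expR (- (x ^+ 2 / 2)) / (27 * `|x|) <= Phi x.
Proof.
move=> x1.
have x0 : x < 0 by lra.
have k_gt0 : 0 < `|x| by rewrite normr_gt0 lt_eqF.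
pose y := x - `|x|^-1.
have yx : y < x by rewrite /y ltrBlDr ltrDl invr_gt0.
rewrite -lee_fin -normal_prob_lt.
apply: (@le_trans _ _ (normal_prob 0 1 `[y, x[%classic)); last first.
  apply: le_measure; rewrite ?inE//; first exact: measurable_lt_set.
  by move=> z /=; rewrite in_itv/= => /andP[].
pose c := expR (- (y ^+ 2 / 2)) / 3.
have c_ge0 : 0 <= c by rewrite divr_ge0 ?expR_ge0.
apply: (@le_trans _ _ (\int[lebesgue_measure]_(z in `[y, x[) c%:E)%E).
  rewrite integral_cst//= lebesgue_measure_itv/= lte_fin yx -EFinB -EFinM lee_fin.
  rewrite /y opprB addrCA subrr addr0 /c invfM mulrA ler_pM2r ?invr_gt0//.
  have -> : (27 : R)^-1 = 9^-1 / 3 by rewrite -invfM; congr (_^-1); ring.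
  rewrite mulrA ler_pM2r ?invr_gt0//.
  have e9 : 9^-1 <= expR (- (3 / 2)) :> R.
    have e2 : 2^-1 <= expR (- (1 / 2)) :> R.
      by apply: le_trans (expR_ge1Dx _); lra.
    have -> : - (3 / 2) = 3%:R * (- (1 / 2)) :> R by lra.
    rewrite expRM_natl; apply: (@le_trans _ _ (2^-1 ^+ 3)); first by lra.
    by rewrite lerXn2r// ?nnegrE ?expR_ge0// invr_ge0.
  apply: (@le_trans _ _ (expR (- (x ^+ 2 / 2)) * expR (- (3 / 2)))).
    by rewrite ler_wpM2l ?expR_ge0.
  rewrite -expRD ler_expR.
  have : `|x|^-1 ^+ 2 <= 1 by rewrite exprn_ile1 ?invr_ge0// invf_le1// ltr0_norm//; lra.
  have : x * `|x|^-1 = -1 by rewrite ltr0_norm// invrN mulrN divff// lt_eqF.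
  set u := `|x|^-1 => xu u1.
  have -> : (x - u) ^+ 2 = x ^+ 2 - 2 * (x * u) + u ^+ 2 by ring.
  rewrite xu; lra.
rewrite /normal_prob; apply: ge0_le_integral => //.
- by apply: measurable_funTS; exact: measurable_normal_pdfE.
move=> z /=; rewrite in_itv/= => /andP[yz zx].
rewrite lee_fin normal_pdfE ?oner_neq0// /c mulrC ler_pM ?expR_ge0//.
- rewrite /normal_peak lef_pV2 ?posrE ?sqrtr_gt0//; last first.
    by rewrite pmulrn_lgt0// mulr_gt0 ?expr1n// pi_gt0.
  rewrite -(ger0_norm (ler0n R 3)) -sqrtr_sqr ler_wsqrtr//.
  by have := @pihalf_lt2 R; lra.
- rewrite /normal_fun ler_expR expr1n subr0 mulNr lerN2 ler_pM2r ?invr_gt0//.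
  nra.
Qed.

Section finite_events.
Context {R : realType} {d : measure_display} {T : measurableType d}.
Variable P : probability T R.

Lemma fine_probU (A B : set T) : measurable A -> measurable B ->
  fine (P (A `|` B)) = fine (P A) + fine (P B) - fine (P (A `&` B)).
Proof.
move=> mA mB.
rewrite measureUfinr ?ltey_eq ?fin_num_measure//.
by rewrite fineB ?fineD ?fin_numD ?fin_num_measure//; exact: measurableI.
Qed.

Lemma fine_prob_le (A B : set T) : measurable A -> measurable B -> A `<=` B ->
  fine (P A) <= fine (P B).
Proof.
move=> mA mB AB; rewrite fine_le ?fin_num_measure//.
by apply: le_measure; rewrite ?inE.
Qed.

Lemma union_bound (K : Type) (r : seq K) (Q : pred K) (G : K -> set T) :
  (forall k, measurable (G k)) ->
  fine (P (\big[setU/set0]_(k <- r | Q k) G k)) <= \sum_(k <- r | Q k) fine (P (G k)).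
Proof.
move=> mG; elim: r => [|k r IHr]; first by rewrite !big_nil measure0.
rewrite !big_cons; case: ifP => // _.
rewrite fine_probU//; last by apply: bigsetU_measurable.
rewrite -addrA lerD2l lerBlDr (le_trans IHr)// lerDl fine_ge0//.
Qed.

(** Adding one event to [n] others loses at most [n * p] by the union bound; [n ^+ 2] bounds the sum
    of these losses. *)
Lemma bonferroni (n : nat) (E : 'I_n -> set T) (q p : R) :
  (forall i, measurable (E i)) -> 0 <= p -> (forall i, q <= fine (P (E i))) ->
  (forall i j : 'I_n, (i < j)%N -> fine (P (E i `&` E j)) <= p) ->
  n%:R * q - n%:R ^+ 2 * p <= fine (P (\big[setU/set0]_i E i)).
Proof.
elim: n E => [|n IHn] E mE p0 qE Ep.
  by rewrite big_ord0 measure0 mul0r expr0n mul0r subrr.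
rewrite big_ord_recr/=.
set U := \big[setU/set0]_(i < n) E (widen_ord (leqnSn n) i).
have mU : measurable U by apply: bigsetU_measurable.
rewrite fine_probU//.
have IH : n%:R * q - n%:R ^+ 2 * p <= fine (P U).
  apply: IHn => // i j ij; exact: Ep.
have UE : fine (P (U `&` E ord_max)) <= n%:R * p.
  rewrite /U big_distrl/=.
  apply: le_trans (union_bound _ _ _) _; first by move=> i; exact: measurableI.
  apply: (@le_trans _ _ (\sum_(i < n) p)); first by apply: ler_sum => i _; apply: Ep => /=.
  by rewrite sumr_const card_ord mulr_natl.
have := qE ord_max.
rewrite -natr1; have : 0 <= n%:R * p by rewrite mulr_ge0.
nra.
Qed.

End finite_events.

(** * The margins of a fixed tuple *)

Lemma fine_probC (R : realType) (d : measure_display) (T : measurableType d)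
    (P : probability T R) (A : set T) : measurable A ->
  fine (P (~` A)) = 1 - fine (P A).
Proof. by move=> mA; rewrite probability_setC// fineB ?fin_num_measure. Qed.

Lemma bigsetU_exists (T : Type) (K : finType) (Q : pred K) (G : K -> set T) :
  \big[setU/set0]_(k | Q k) G k = [set w | exists2 k, Q k & G k w].
Proof.
apply/seteqP; split=> w /=.
  by elim/big_ind: _ => //= [A B IA IB [/IA|/IB]//|k Qk Gk]; exists k.
by move=> [k Qk Gkw]; rewrite (bigD1 k)//; left.
Qed.

Lemma inner_sign (R : realType) (N : nat) (u : 'cV[R]_N) :
  sign_vector u -> inner u u = N%:R.
Proof.
move=> su; rewrite /inner (eq_bigr (fun=> 1)) ?sumr_const ?card_ord//.
by move=> b _; case: (su b) => ->; rewrite ?mulrNN mulr1.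
Qed.

Section rows.
Context {R : realType} {m M N : nat}.
Implicit Types (a : 'I_M) (i : 'I_m) (u v : 'cV[R]_N).

Definition row_entries a : {set 'I_m.+1 * 'I_M * 'I_N} := [set j | j.1.2 == a]%SET.

(** Coefficient of the entry [j] in a margin of its own row; only the shared matrix and the [i]-th
    private one contribute. *)
Definition row_coef (t : R) i u (j : 'I_m.+1 * 'I_M * 'I_N) : R :=
  (cos t * (j.1.1 == ord0)%:R + sin t * (j.1.1 == lift ord0 i)%:R) * u j.2 0.

Lemma sum_row_entries a (F : 'I_m.+1 * 'I_M * 'I_N -> R) :
  \sum_(j in row_entries a) F j = \sum_b \sum_k F (k, a, b).
Proof.
rewrite exchange_big pair_big/=.
rewrite (reindex_onto (fun p : 'I_m.+1 * 'I_N => (p.1, a, p.2))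
  (fun j => (j.1.1, j.2)))/=.
  by apply: eq_bigl => -[k b]; rewrite !inE/= !eqxx.
by move=> [[k a'] b]; rewrite inE/= => /eqP ->.
Qed.

Lemma sum_delta2 (c s : R) i (G : 'I_m.+1 -> R) :
  \sum_k (c * (k == ord0)%:R + s * (k == lift ord0 i)%:R) * G k =
  c * G ord0 + s * G (lift ord0 i).
Proof.
under eq_bigr do rewrite mulrDl.
rewrite big_split/=; congr (_ + _).
  rewrite (bigD1 ord0)//= mulr1 big1 ?addr0// => k /negbTE ->.
  by rewrite mulr0 mul0r.
rewrite (bigD1 (lift ord0 i))//= eqxx mulr1 big1 ?addr0// => k /negbTE ->.
by rewrite mulr0 mul0r.
Qed.

(** This is the covariance of two margins of one row: the cosines come from the shared matrix, the
    sines from the private matrices, which meet only when [i = i']. *)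
Lemma sum_row_coefM a t t' i i' u v :
  \sum_(j in row_entries a) row_coef t i u j * row_coef t' i' v j =
  (cos t * cos t' + sin t * sin t' * (i == i')%:R) * inner u v.
Proof.
rewrite sum_row_entries /inner mulr_sumr; apply: eq_bigr => b _.
rewrite /row_coef/=; under eq_bigr do rewrite -mulrA.
rewrite sum_delta2 !eqxx (inj_eq (@lift_inj _ ord0)).
have lift0F k : (lift ord0 k == ord0 :> 'I_m.+1) = false by [].
by rewrite lift0F (negbTE (neq_lift _ _)) !mulr0 addr0 add0r mulr1; ring.
Qed.

Context {d : measure_display} {T : measurableType d} {P : probability T R}.
Variable X : 'I_m.+1 * 'I_M * 'I_N -> {RV P >-> R}.

Definition margin (w : T) t i u a : R :=
  (interpolated (random_matrices X w) t i *m u) a 0.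

Lemma marginE w t i u a :
  margin w t i u a = \sum_(j in row_entries a) row_coef t i u j * X j w.
Proof.
rewrite sum_row_entries /margin mxE; apply: eq_bigr => b _.
rewrite /row_coef/= !mxE; under eq_bigr do rewrite -mulrA.
by rewrite sum_delta2; ring.
Qed.

Lemma sigma_cylinders_margin t i u a (B : set R) : measurable B ->
  <<s cylinders X (row_entries a) >> [set w | B (margin w t i u a)].
Proof.
move=> mB; under eq_set do rewrite marginE.
exact: sigma_cylinders_sum.
Qed.

Lemma measurable_margin t i u a (B : set R) : measurable B ->
  measurable [set w | B (margin w t i u a)].
Proof.
move=> mB; apply: (@sigma_cylinders_measurable _ _ _ _ _ X (row_entries a)).
exact: sigma_cylinders_margin.
Qed.

Hypothesis iidX : iid_standard_normal X.
Hypothesis N_gt0 : (0 < N)%N.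

Let N0 : 0 < N%:R :> R.
Proof. by rewrite ltr0n. Qed.

Let sN0 : 0 < Num.sqrt N%:R :> R.
Proof. by rewrite sqrtr_gt0. Qed.

(** The variance is [N] whatever the angle, because [cos^2 + sin^2 = 1]. *)
Lemma prob_margin_lt (kappa : R) t i u a : sign_vector u ->
  P [set w | margin w t i u a < kappa * Num.sqrt N%:R] = (Phi kappa)%:E.
Proof.
move=> su.
have sumsq : \sum_(j in row_entries a) row_coef t i u j ^+ 2 = N%:R.
  under eq_bigr do rewrite expr2.
  by rewrite sum_row_coefM eqxx mulr1 -!expr2 cos2Dsin2 mul1r inner_sign.
have mlt := @measurable_lt_set R (kappa * Num.sqrt N%:R).
under eq_set do rewrite marginE.
rewrite (normal_lincomb iidX mlt) ?sumsq//.
have -> : Num.sqrt N%:R = `|Num.sqrt N%:R| * 1 :> R by rewrite mulr1 ger0_norm.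
rewrite -normal_prob_scale ?gt_eqF// ?mulr1 ?ger0_norm//.
rewrite -normal_prob_lt; congr (normal_prob 0 1 _).
by apply/seteqP; split=> x /=; rewrite mulrC ltr_pM2r.
Qed.

(** Both failures push the sum of the margins below twice the threshold. Cosines in [[0, 1]] and an
    overlap of at most [beta * N] keep its variance at most [2 * N * (1 + beta)], and the Gaussian
    tail bound concludes. *)
Lemma prob_margin_pair (kappa beta t t' : R) i i' u v a :
  kappa <= 0 -> i != i' -> sign_vector u -> sign_vector v ->
  0 <= t <= pi / 2 -> 0 <= t' <= pi / 2 ->
  0 <= inner u v <= beta * N%:R ->
  fine (P ([set w | margin w t i u a < kappa * Num.sqrt N%:R] `&`
           [set w | margin w t' i' v a < kappa * Num.sqrt N%:R])) <=
  expR (- (kappa ^+ 2 / (1 + beta))).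
Proof.
move=> k0 ii' su sv t01 t'01 /andP[uv0 uvb].
have cos01 (x : R) : 0 <= x <= pi / 2 -> 0 <= cos x <= 1.
  move=> /andP[x0 x1]; rewrite cos_le1 andbT cos_ge0_pihalf// x1 andbT.
  by rewrite (le_trans _ x0)// oppr_le0 divr_ge0 ?pi_ge0.
have /andP[ct0 ct1] := cos01 _ t01; have /andP[ct'0 ct'1] := cos01 _ t'01.
pose c j := row_coef t i u j + row_coef t' i' v j.
pose var := \sum_(j in row_entries a) c j ^+ 2.
have varE : var = 2 * N%:R + 2 * (cos t * cos t' * inner u v).
  rewrite /var; under eq_bigr do rewrite /c sqrrD !expr2.
  rewrite !big_split/= !sum_row_coefM !eqxx ?(negbTE ii').
  rewrite !mulr1 !mulr0 addr0 -!expr2 !cos2Dsin2 !mul1r !inner_sign//.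
  by ring.
have cc0 : 0 <= cos t * cos t' * inner u v by rewrite !mulr_ge0.
have cc1 : cos t * cos t' * inner u v <= beta * N%:R.
  by apply: le_trans uvb; rewrite ler_piMl// mulr_ile1.
have var0 : 0 < var by rewrite varE ltr_wpDr ?mulr_gt0 ?mulr_ge0.
have b0 : 0 <= beta by rewrite -(pmulr_lge0 _ N0) (le_trans uv0).
pose x := kappa * Num.sqrt N%:R.
have mx := @measurable_lt_set R x; have m2x := @measurable_lt_set R (2 * x).
have sumE w : margin w t i u a + margin w t' i' v a =
    \sum_(j in row_entries a) c j * X j w.
  by rewrite !marginE -big_split; apply: eq_bigr => j _; rewrite /c mulrDl.
apply: (@le_trans _ _ (fine (P
    [set w | [set y | y < 2 * x] (\sum_(j in row_entries a) c j * X j w)]))).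
  apply: fine_prob_le.
  - by apply: measurableI; [exact: (measurable_margin t i u a mx)
      |exact: (measurable_margin t' i' v a mx)].
  - have := measurable_lincomb X (row_entries a) c.
    by move=> /(_ measurableT _ m2x); rewrite setTI.
  - move=> w /= [wx w'x]; rewrite -sumE -/x in wx w'x *.
    by rewrite mulr_natl mulr2n ltrD.
rewrite (normal_lincomb iidX m2x)// -/var.
have sv0 : Num.sqrt var != 0 by rewrite gt_eqF// sqrtr_gt0.
have x0 : 2 * x <= 0 by rewrite pmulr_rle0// mulr_le0_ge0.
have tail := normal_prob_tail sv0 x0.
apply: (@le_trans _ _ (expR (- ((2 * x) ^+ 2 / (Num.sqrt var ^+ 2 *+ 2))))).
  by rewrite -lee_fin fineK// fin_num_measure.
rewrite ler_expR lerN2 (sqr_sqrtr (ltW var0)) /x !exprMn (sqr_sqrtr (ltW N0)).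
have b1 : 0 < 1 + beta by rewrite ltr_wpDr.
rewrite (ler_pdivrMr _ _ b1) mulrAC ler_pdivlMr ?pmulrn_lgt0//.
have : var <= 2 * N%:R * (1 + beta) by rewrite varE; lra.
have : 0 <= kappa ^+ 2 by exact: sqr_ge0.
rewrite -mulr_natr; nra.
Qed.

Variables (kappa beta : R) (tau : 'I_m -> R) (theta : 'I_m -> 'cV[R]_N).
Hypotheses (k0 : kappa <= 0) (b0 : 0 <= beta).
Hypothesis tau01 : forall i, 0 <= tau i <= pi / 2.
Hypothesis sign_theta : forall i, sign_vector (theta i).

Let fails a i := [set w | margin w (tau i) i (theta i) a < kappa * Num.sqrt N%:R].
Let passes a :=
  [set w | forall i, kappa * Num.sqrt N%:R <= margin w (tau i) i (theta i) a].

Let measurable_fails a i : measurable (fails a i).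
Proof. exact: (measurable_margin (tau i) i (theta i) a
  (@measurable_lt_set R _)). Qed.

Let passesE a : passes a = ~` (\big[setU/set0]_i fails a i).
Proof.
rewrite bigsetU_exists; apply/seteqP; split=> w /=.
  by move=> pw [i _]; rewrite /fails/= ltNge pw.
move=> nw i; rewrite leNgt; apply/negP => fw; apply: nw.
by exists i.
Qed.

Definition all_pass : set T :=
  [set w | forall i a, kappa * Num.sqrt N%:R <= margin w (tau i) i (theta i) a].

Lemma sigma_cylinders_passes a : <<s cylinders X (row_entries a) >> (passes a).
Proof.
have -> : passes a = \bigcap_(i in [set: 'I_m])
    [set w | [set y | kappa * Num.sqrt N%:R <= y] (margin w (tau i) i (theta i) a)].
  by apply/seteqP; split=> w /= pw i; [move=> _; exact: pw|exact: pw I].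
apply: (@fin_bigcap_measurable _ (g_sigma_algebraType (cylinders X (row_entries a)))) => //.
move=> i _; apply: sigma_cylinders_margin.
by rewrite -set_itvE.
Qed.

Let measurable_passes a : measurable (passes a).
Proof.
apply: (@sigma_cylinders_measurable _ _ _ _ _ X (row_entries a)).
exact: sigma_cylinders_passes.
Qed.

(** Different rows involve disjoint groups of entries. *)
Lemma prob_all_pass : P all_pass = (\prod_a P (passes a))%E.
Proof.
rewrite -(sigma_cylinders_prod (proj1 iidX) (rho := fun j => j.1.2)).
  by congr (P _); apply/seteqP; split=> w /= h ? ?; exact: h.
exact: sigma_cylinders_passes.
Qed.

Lemma measurable_all_pass : measurable all_pass.
Proof.
have -> : all_pass = \bigcap_(a in [set: 'I_M]) passes a.
  by apply/seteqP; split=> w /= h ? ?; [move=> ?; exact: h|exact: h].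
exact: fin_bigcap_measurable.
Qed.

Lemma fine_prob_all_pass : fine (P all_pass) = \prod_a fine (P (passes a)).
Proof.
rewrite prob_all_pass -[RHS]/(fine _%:E) -prodEFin.
congr fine; apply: eq_bigr => a _; rewrite fineK// fin_num_measure//.
Qed.

Lemma all_pass_ge : m%:R * Phi kappa <= 1 ->
  (1 - m%:R * Phi kappa) ^+ M <= fine (P all_pass).
Proof.
move=> mPhi; rewrite fine_prob_all_pass -[X in _ ^+ X]card_ord -prodr_const.
apply: ler_prod => a _; rewrite subr_ge0 mPhi/= passesE fine_probC; last first.
  exact: bigsetU_measurable.
rewrite lerB//; apply: le_trans (union_bound _ _ _ _) _ => //.
by rewrite (eq_bigr (fun=> Phi kappa)) ?sumr_const ?card_ord ?mulr_natl// => i _;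
  rewrite prob_margin_lt.
Qed.

Lemma all_pass_le :
  (forall i j : 'I_m, (i < j)%N ->
     0 <= inner (theta i) (theta j) <= beta * N%:R) ->
  fine (P all_pass) <= expR (- (M%:R * (m%:R * Phi kappa -
    m%:R ^+ 2 * expR (- (kappa ^+ 2 / (1 + beta)))))).
Proof.
move=> overlap; rewrite fine_prob_all_pass -mulrN expRM_natl.
rewrite -[X in _ ^+ X]card_ord -prodr_const.
apply: ler_prod => a _; rewrite fine_ge0//= passesE fine_probC; last first.
  exact: bigsetU_measurable.
apply: le_trans (expR_ge1Dx _); rewrite lerD2l lerN2.
apply: bonferroni => //.
  by move=> i; rewrite prob_margin_lt.
by move=> i j ij; apply: prob_margin_pair => //; [rewrite neq_ltn ij|exact: overlap].
Qed.

End rows.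

(** * Counting admissible tuples *)

Lemma expR_sum_ord (R : realType) (N : nat) (F : 'I_N -> R) :
  expR (\sum_b F b) = \prod_b expR (F b).
Proof. by apply: (big_morph expR); [exact: expRD|exact: expR0]. Qed.

Section signs.
Context {R : realType}.
Variable N : nat.
Implicit Types s : {ffun 'I_N -> bool}.

(** Sign vectors are encoded by a finite type, so that they can be counted and union bounds are
    finite. *)
Definition sign_col s : 'cV[R]_N := \col_b (if s b then 1 else -1).

Lemma sign_col_sign s : sign_vector (sign_col s).
Proof. by move=> b; rewrite mxE; case: (s b); [left|right]. Qed.

Lemma sign_colP (u : 'cV[R]_N) : sign_vector u -> u = sign_col [ffun b => u b 0 == 1].
Proof.
move=> su; apply/colP => b; rewrite mxE ffunE.
case: (su b) => ->; first by rewrite eqxx.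
by rewrite -subr_eq0 -opprD oppr_eq0 -mulr2n pnatr_eq0.
Qed.

Definition hamming s s' : R := \sum_b (s b != s' b)%:R.

Lemma inner_sign_col s s' :
  inner (sign_col s) (sign_col s') = N%:R - 2 * hamming s s'.
Proof.
rewrite /inner /hamming mulr_sumr -[X in X%:R]card_ord -sumr_const -sumrB.
apply: eq_bigr => b _; rewrite !mxE; case: (s b); case: (s' b) => /=; lra.
Qed.

(* Exponential Chebyshev: weighting a point at distance [h] by [delta ^ h]
   makes the sum over the cube factor over the coordinates. *)
Lemma hamming_ball s (delta : R) : 0 < delta -> delta <= 1 ->
  \sum_(s' | hamming s s' <= delta * N%:R) 1 <=
  expR (N%:R * (delta - delta * ln delta)).
Proof.
move=> d0 d1; rewrite mulrBr expRD.
have lnd : ln delta <= 0 by rewrite ln_le0.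
apply: (@le_trans _ _ (\sum_(s' : {ffun 'I_N -> bool})
    expR (- (N%:R * (delta * ln delta))) *
    \prod_b expR (ln delta * (s b != s' b)%:R))).
  rewrite [leRHS](bigID (fun s' => hamming s s' <= delta * N%:R))/= -[leLHS]addr0.
  rewrite lerD ?sumr_ge0// => [|s' _]; last first.
    by rewrite mulr_ge0 ?expR_ge0// prodr_ge0// => b _; exact: expR_ge0.
  apply: ler_sum => s' hs; rewrite -expR_sum_ord -mulr_sumr -expRD.
  rewrite -[leLHS]expR0 ler_expR -/(hamming s s').
  have hs0 : hamming s s' - delta * N%:R <= 0 by rewrite subr_le0.
  by have := mulr_le0 lnd hs0; congr (_ <= _); ring.
rewrite -mulr_sumr mulrC ler_wpM2r ?expR_ge0//.
rewrite -(bigA_distr_bigA (fun b c => expR (ln delta * (s b != c)%:R))).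
rewrite expRM_natl -[X in _ ^+ X]card_ord -prodr_const.
apply: ler_prod => b _; rewrite sumr_ge0/= => [|c _]; last exact: expR_ge0.
rewrite big_bool; case: (s b); rewrite /= mulr1 mulr0 expR0 lnK ?posrE//.
  exact: expR_ge1Dx.
by rewrite addrC; exact: expR_ge1Dx.
Qed.

(** There are [2 ^ N <= exp N] choices of a centre, and then every vector of the tuple lies in the
    Hamming ball around it. *)
Lemma close_tuples_count (m : nat) (i0 : 'I_m) (delta : R) : 0 < delta -> delta <= 1 ->
  \sum_(f : {ffun 'I_m -> {ffun 'I_N -> bool}} |
      [forall j, hamming (f i0) (f j) <= delta * N%:R]) 1 <=
  expR (N%:R * (1 + m%:R * (delta - delta * ln delta))).
Proof.
move=> d0 d1.
pose near_ s s' : R := (hamming s s' <= delta * N%:R)%R%:R.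
apply: (@le_trans _ _ (\sum_s \sum_(f : {ffun 'I_m -> {ffun 'I_N -> bool}})
    \prod_j near_ s (f j))).
  rewrite exchange_big/= big_mkcond/=; apply: ler_sum => f _.
  have prod01 s : 0 <= \prod_j near_ s (f j) by apply: prodr_ge0.
  case: ifPn => [/forallP fP|_]; last by rewrite sumr_ge0.
  (* Of all centres only [f i0] is kept; its product is already 1. *)
  rewrite (bigD1 (f i0))//= big1 ?lerDl ?sumr_ge0// => j _.
  by rewrite /near_ fP.
rewrite (eq_bigr (fun s => \prod_(j < m) \sum_s' near_ s s')); last first.
  by move=> s _; rewrite bigA_distr_bigA.
apply: (@le_trans _ _ (\sum_(s : {ffun 'I_N -> bool})
    expR (N%:R * (delta - delta * ln delta)) ^+ m)).
  apply: ler_sum => s _; rewrite -[X in _ ^+ X]card_ord -prodr_const.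
  apply: ler_prod => j _; rewrite sumr_ge0//=.
  apply: le_trans (hamming_ball s d0 d1); rewrite [leRHS]big_mkcond/=.
  by apply: ler_sum => s' _; rewrite /near_; case: ifP.
rewrite sumr_const card_ffun card_bool card_ord -[leLHS]mulr_natl.
set ent := delta - delta * ln delta.
rewrite [in leRHS]mulrDr mulr1 expRD -expRM_natl mulrCA ler_wpM2r ?expR_ge0//.
rewrite natrX -[N%:R in leRHS]mulr1 expRM_natl.
by rewrite lerXn2r ?nnegrE ?expR_ge0//; apply: le_trans (expR_ge1Dx _); lra.
Qed.

End signs.

(** * An explicit admissible tuple *)

Section disjoint_blocks.
Context {R : realType}.

Lemma sum_block (N k i : nat) : (i.+1 * k <= N)%N ->
  \sum_(b < N) (i * k <= b < i.+1 * k)%:R = k%:R :> R.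
Proof.
move=> ikN; rewrite -(big_mkord xpredT (fun b => (i * k <= b < i.+1 * k)%:R)).
have ik : (i * k <= i.+1 * k)%N by rewrite leq_mul2r leqnSn orbT.
rewrite (big_cat_nat (n := i * k))//=; last exact: leq_trans ikN.
rewrite big_nat_cond big1 ?add0r; last first.
  by move=> b /andP[/andP[_ bik] _]; rewrite leqNgt bik.
rewrite (big_cat_nat (n := i.+1 * k))//= [X in _ + X]big_nat_cond.
rewrite [X in _ + X]big1 ?addr0; last first.
  by move=> b /andP[/andP[ikb _] _]; rewrite [(b < _)%N]ltnNge ikb andbF.
rewrite big_nat_cond (eq_bigr (fun=> 1)); last by move=> b /andP[->].
by rewrite -big_nat_cond big_const_nat iter_addr addr0 mulSn addnK.
Qed.

Definition block_sign (N k : nat) (i : nat) : 'cV[R]_N :=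
  \col_(b < N) (1 - 2 * (i * k <= b < i.+1 * k)%:R).

Lemma block_sign_sign N k i : sign_vector (block_sign N k i).
Proof.
by move=> b; rewrite mxE; case: andP => _ /=; [right|left]; lra.
Qed.

(** The two vectors differ exactly on two disjoint blocks of [k] coordinates, and each such
    coordinate lowers the product by 2. *)
Lemma inner_block_sign (N k i j : nat) : (i < j)%N -> (j.+1 * k <= N)%N ->
  inner (block_sign N k i) (block_sign N k j) = N%:R - 4 * k%:R.
Proof.
move=> ij jkN.
have ikj : (i.+1 * k <= j * k)%N by rewrite leq_mul2r ij orbT.
have jj : (j * k <= j.+1 * k)%N by rewrite leq_mul2r leqnSn orbT.
transitivity (\sum_(b < N) (1 - 2 * ((i * k <= b < i.+1 * k)%:R +
    (j * k <= b < j.+1 * k)%:R)) : R).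
  apply: eq_bigr => b _; rewrite !mxE.
  case: (boolP (i * k <= b < i.+1 * k)%N) => [/andP[_ bi]|_] /=; last by ring.
  by rewrite [(j * k <= b)%N]leqNgt (leq_trans bi ikj) /=; ring.
rewrite sumrB -mulr_sumr big_split/= !sum_block//; last first.
  by rewrite (leq_trans ikj)// (leq_trans jj).
by rewrite sumr_const card_ord; ring.
Qed.

End disjoint_blocks.

(** * Bounds on the probability that a solution exists *)

Section solutions.
Context {R : realType} {d : measure_display} {T : measurableType d}
  {P : probability T R} {m M N : nat}.
Variables (X : 'I_m.+1 * 'I_M * 'I_N -> {RV P >-> R}).
Variables (kappa beta eta : R) (I : {fset R}).
Hypothesis iidX : iid_standard_normal X.
Hypothesis N_gt0 : (0 < N)%N.
Hypothesis k0 : kappa <= 0.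
Hypothesis I01 : forall t, t \in I -> 0 <= t <= pi / 2.

Definition has_solution : set T :=
  [set w | solution_tuples kappa beta eta [set` I] (random_matrices X w) !=set0].

Let index := ({ffun 'I_m -> {ffun 'I_N -> bool}} * {ffun 'I_m -> I})%type.

Let admissible (f : {ffun 'I_m -> {ffun 'I_N -> bool}}) :=
  [forall i : 'I_m, forall j : 'I_m, (i < j)%N ==>
    (beta - eta < N%:R^-1 * inner (sign_col (f i)) (sign_col (f j)) < beta)].

Let pass (k : index) :=
  all_pass X kappa (fun i => fsval (k.2 i)) (fun i => sign_col (k.1 i)).

(** A finite union over sign patterns and angle tuples: it gives both measurability and the first
    moment bound. *)
Let has_solutionE :
  has_solution = \big[setU/set0]_(k : index | admissible k.1) pass k.
Proof.
rewrite bigsetU_exists; apply/seteqP; split=> w /=.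
  move=> [theta [sth [ov [tau [tauI ineq]]]]].
  have thE i : theta i = sign_col [ffun b => theta i b 0 == 1].
    exact: sign_colP.
  exists ([ffun i => [ffun b => theta i b 0 == 1]], [ffun i => [` tauI i]%fset]).
    apply/forallP => i; apply/forallP => j; apply/implyP => ij.
    by rewrite !ffunE -!thE; exact: ov.
  by move=> i a /=; rewrite !ffunE/= -thE; exact: ineq.
move=> [[f t]/= /forallP adm pf]; exists (fun i => sign_col (f i)); split=> [i|].
  exact: sign_col_sign.
split=> [i j ij|]; first by have /forallP/(_ j)/implyP/(_ ij) := adm i.
by exists (fun i => fsval (t i)); split=> [i|]; [exact: fsvalP|exact: pf].
Qed.

Let measurable_pass k : measurable (pass k).
Proof. exact: measurable_all_pass. Qed.

Lemma measurable_has_solution : measurable has_solution.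
Proof. by rewrite has_solutionE; exact: bigsetU_measurable. Qed.

Lemma has_solution_ge (theta : 'I_m -> 'cV[R]_N) (t : R) :
  t \in I -> (forall i, sign_vector (theta i)) ->
  (forall i j : 'I_m, (i < j)%N ->
     beta - eta < N%:R^-1 * inner (theta i) (theta j) < beta) ->
  m%:R * Phi kappa <= 1 ->
  (1 - m%:R * Phi kappa) ^+ M <= fine (P has_solution).
Proof.
move=> tI sth ov mPhi.
apply: le_trans (all_pass_ge iidX N_gt0 (fun=> t) sth mPhi) _.
apply: fine_prob_le; [exact: measurable_all_pass|exact: measurable_has_solution|].
move=> w pw; exists theta; split=> //; split=> //.
by exists (fun=> t); split.
Qed.

(** The exponent collects the number of sign tuples, the [#|I| ^ m] angle tuples and the success
    probability of one choice. An overlap above [1 - 2 * delta] is a Hamming distance below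
    [delta * N]. The centre has index 0 because overlaps are constrained only for [i < j]. *)
Lemma has_solution_le (i0 : 'I_m) (c delta : R) :
  i0 = 0%N :> nat -> 0 <= beta -> 0 <= beta - eta -> 0 < delta -> delta <= 1 ->
  1 - beta + eta = 2 * delta -> #|` I|%:R <= expR (c * N%:R) ->
  fine (P has_solution) <=
  expR (N%:R * (1 + m%:R * (delta - delta * ln delta)) + m%:R * (c * N%:R) -
    M%:R * (m%:R * Phi kappa - m%:R ^+ 2 * expR (- (kappa ^+ 2 / (1 + beta))))).
Proof.
move=> i00 b0 be0 d0 d1 deltaE cardI.
have N0 : 0 < N%:R :> R by rewrite ltr0n.
rewrite has_solutionE; apply: le_trans (union_bound _ _ _ measurable_pass) _.
set bound := M%:R * _.
apply: (@le_trans _ _ (\sum_(k : index | admissible k.1) expR (- bound))).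
  apply: ler_sum => k /forallP adm; apply: all_pass_le => //.
  - by move=> i; apply: I01; exact: fsvalP.
  - by move=> i; exact: sign_col_sign.
  move=> i j ij; have /forallP/(_ j)/implyP/(_ ij)/andP[lo up] := adm i.
  rewrite mulrC ltr_pdivrMr// in up; rewrite mulrC ltr_pdivlMr// in lo.
  by rewrite (ltW up) andbT (le_trans _ (ltW lo))// mulr_ge0.
have -> : \sum_(k : index | admissible k.1) expR (- bound) =
    (\sum_(f | admissible f) 1) * (\sum_(t : {ffun 'I_m -> I}) 1) * expR (- bound).
  rewrite big_distrlr/= pair_big_dep/= mulr_suml.
  by apply: eq_big => [k|k _]; rewrite ?andbT ?mul1r.
rewrite [X in _ * X * _](_ : _ = (#|` I|%:R : R) ^+ m); last first.
  by rewrite sumr_const card_ffun card_ord -cardfE natrX.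
rewrite !expRD ler_wpM2r ?expR_ge0//.
rewrite ler_pM ?exprn_ge0 ?sumr_ge0//; last first.
  by rewrite expRM_natl lerXn2r ?nnegrE ?expR_ge0.
apply: le_trans (close_tuples_count N i0 d0 d1).
rewrite big_mkcond [leRHS]big_mkcond/=; apply: ler_sum => f _.
case: (boolP (admissible f)) => [/forallP adm|_]; last by case: ifP.
rewrite ifT//; apply/forallP => j.
have [->|j0] := eqVneq j i0.
  by rewrite /hamming big1 ?mulr_ge0 ?ltW// => b _; rewrite eqxx.
have i0j : (i0 < j)%N by rewrite i00 lt0n -i00.
have /forallP/(_ j)/implyP/(_ i0j)/andP[+ _] := adm i0.
rewrite mulrC ltr_pdivlMr// inner_sign_col.
have -> : beta - eta = 1 - 2 * delta by rewrite -deltaE; ring.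
lra.
Qed.

End solutions.

(** * Choice of the parameters *)

Section parameters.
Context {R : realType}.
(* [l] stands for [ln `|kappa|], hence [K] for [`|kappa|]; [delta] and [m] are the
   values given to both [eta] and [1 - beta], and to the number of vectors. *)
Variable l : R.
Hypothesis l20 : 20 <= l.
Let K := expR l.

Let delta := 16 * l / K ^+ 2.
Let m := (Num.truncn (K ^+ 2 / l ^+ 2)).+1.

Let l0 : 0 < l.
Proof. by apply: lt_le_trans l20. Qed.

Let K0 : 0 < K.
Proof. exact: expR_gt0. Qed.

Lemma expR_ge201 : 201 <= K.
Proof.
have := @expR_ge1Dxn R l 1 (ltW l0).
by rewrite -/K (_ : 2`! = 2)%N//; have := l20; nra.
Qed.

Lemma le_expR_id : l <= K.
Proof. by have := expR_ge1Dx l; rewrite -/K; lra. Qed.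

Lemma delta_gt0 : 0 < delta.
Proof. by rewrite divr_gt0 ?exprn_gt0// mulr_gt0. Qed.

Lemma delta_small : delta <= 1 / 10.
Proof.
rewrite ler_pdivrMr ?exprn_gt0//; have := expR_ge201; have := le_expR_id; have := l0; nra.
Qed.

(** As [- ln delta <= 2 * l] and [1 <= l], the left side is at most [3 * l * delta]. *)
Lemma entropy_le : delta - delta * ln delta <= 48 * (l ^+ 2 / K ^+ 2).
Proof.
have lnE : ln delta = ln (16 * l) - 2 * l.
  rewrite /delta ln_div ?posrE ?exprn_gt0 ?mulr_gt0//.
  by rewrite -expRM_natl expRK.
have ln0 : 0 <= ln (16 * l) by rewrite ln_ge0//; have := l20; lra.
have -> : 48 * (l ^+ 2 / K ^+ 2) = 3 * l * delta by rewrite /delta; ring.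
rewrite lnE; have := delta_gt0; have := l20; nra.
Qed.

Lemma tuple_size_ge : 1 <= m%:R * (l ^+ 2 / K ^+ 2).
Proof.
have := truncnS_gt (K ^+ 2 / l ^+ 2); rewrite -/m => /ltW.
by rewrite -[_ ^+ 2 / K ^+ 2]invrK invf_div ler_pdivlMr ?divr_gt0 ?exprn_gt0// mul1r.
Qed.

Lemma tuple_size_le : m%:R <= K ^+ 2 / l ^+ 2 + 1.
Proof.
by rewrite /m -natr1 lerD2r truncn_le divr_ge0// exprn_ge0// ltW.
Qed.

Lemma tuple_size_le_sqr : m%:R <= K ^+ 2 / 100.
Proof.
apply: le_trans tuple_size_le _.
have : K ^+ 2 / l ^+ 2 <= K ^+ 2 / 400.
  by rewrite ler_wpM2l ?sqr_ge0// lef_pV2 ?posrE ?exprn_gt0//; have := l20; nra.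
have := expR_ge201; nra.
Qed.

(** Makes room for [m] disjoint blocks of length at most [3 / 8 * delta * N]. *)
Lemma tuple_size_delta : m%:R * delta <= 2.
Proof.
apply: (@le_trans _ _ ((K ^+ 2 / l ^+ 2 + 1) * delta)).
  by rewrite ler_wpM2r ?tuple_size_le// ltW// delta_gt0.
rewrite mulrDl mul1r.
have -> : K ^+ 2 / l ^+ 2 * delta = 16 / l.
  by rewrite /delta; field; rewrite !gt_eqF.
have : 16 / l <= 1 by rewrite ler_pdivrMr//; have := l20; lra.
have := delta_small; lra.
Qed.

Variable kappa : R.
Hypothesis kappaE : kappa = - K.

Let k0 : kappa <= 0.
Proof. by rewrite kappaE oppr_le0 ltW. Qed.

Lemma Phi_ge : expR (- (K ^+ 2 / 2)) / (27 * K) <= Phi kappa.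
Proof.
have := @Phi_lower R kappa; rewrite kappaE sqrrN normrN gtr0_norm//; apply.
by have := expR_ge201; lra.
Qed.

Lemma Phi_gt0 : 0 < Phi kappa.
Proof.
by apply: lt_le_trans Phi_ge; rewrite divr_gt0 ?expR_gt0// mulr_gt0.
Qed.

Lemma tuple_size_Phi : m%:R * Phi kappa <= 1 / 2.
Proof.
have h1 : Phi kappa <= expR (- (K ^+ 2 / 2)).
  by have := Phi_tail k0; rewrite kappaE sqrrN.
have h2 : K ^+ 2 / 2 <= expR (K ^+ 2 / 2).
  by apply: le_trans (expR_ge1Dx _); rewrite lerDr.
have Phi0 := Phi_gt0.
apply: (@le_trans _ _ (K ^+ 2 / 100 * expR (- (K ^+ 2 / 2)))).
  by rewrite ler_pM ?ler0n ?tuple_size_le_sqr// ltW.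
rewrite expRN ler_pdivrMr ?expR_gt0//.
have := expR_ge201; nra.
Qed.

(** The 16 in [delta] is used here: [K^2 / (2 - delta)] exceeds [K^2 / 2] by at least
    [delta * K^2 / 4 = 4 * l], which gains a factor [K ^- 4]. This beats both [m], of order at most
    [K^2], and the factor [1 / K] in the lower bound on [Phi]. *)
Lemma tuple_size_pair :
  m%:R * expR (- (kappa ^+ 2 / (1 + (1 - delta)))) <= Phi kappa / 2.
Proof.
have d0 := delta_gt0; have d1 := delta_small.
have k2 : K ^+ 2 / 2 + 4 * l <= kappa ^+ 2 / (1 + (1 - delta)).
  rewrite kappaE sqrrN ler_pdivlMr; last by lra.
  have : delta * K ^+ 2 = 16 * l by rewrite /delta divfK// gt_eqF// exprn_gt0.
  nra.
apply: (@le_trans _ _ (K ^+ 2 / 100 * (expR (- (K ^+ 2 / 2)) * expR (- (4%:R * l))))).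
  by rewrite -expRD ler_pM ?ler0n ?expR_ge0 ?tuple_size_le_sqr// ler_expR -opprD lerN2.
apply: (@le_trans _ _ (expR (- (K ^+ 2 / 2)) / (27 * K) / 2)); last first.
  by rewrite ler_pM2r ?invr_gt0// Phi_ge.
rewrite mulrCA -[leRHS]mulrA ler_pM2l ?expR_gt0//.
rewrite expRN expRM_natl -/K.
have -> : K ^+ 2 / 100 / K ^+ 4 = (100 * K ^+ 2)^-1 by field; rewrite gt_eqF.
rewrite -invfM lef_pV2 ?posrE ?mulr_gt0 ?exprn_gt0//.
have := expR_ge201; nra.
Qed.

End parameters.

(** The rate [exp (- Theta(N))] is a two-sided bound whose constants are fixed before [I] and the
    probability space. A nonempty [I] supplies the angle for the lower bound; with [I] empty the
    event is empty, as [m > 0]. *)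
Theorem theorem4p2 (R : realType) :
  exists C1 kappa1 : R, 0 < C1 /\ kappa1 < 0 /\
  forall kappa alpha : R, kappa < kappa1 ->
    C1 * ln `|kappa| ^+ 2 / (kappa ^+ 2 * Phi kappa) < alpha ->
  exists (eta beta c : R) (m : nat),
    0 < eta /\ eta < beta /\ beta < 1 /\ 0 < c /\ (0 < m)%N /\
  forall M : nat -> nat,
    (fun N : nat => (M N)%:R / N%:R : R) @ \oo --> alpha ->
  exists c1 c2 : R, 0 < c1 /\ 0 < c2 /\
  \forall N \near \oo,
    forall I : {fset R}, I != fset0 ->
      (forall t, t \in I -> 0 <= t <= pi / 2) ->
      (#|` I|)%:R <= expR (c * N%:R) ->
    forall (d : measure_display) (T : measurableType d) (P : probability T R)
      (X : 'I_m.+1 * 'I_(M N) * 'I_N -> {RV P >-> R}),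
      iid_standard_normal X ->
      ((expR (- (c2 * N%:R)))%:E
       <= P [set w | solution_tuples kappa beta eta [set` I]
                       (random_matrices X w) !=set0]
       <= (expR (- (c1 * N%:R)))%:E)%E.
Proof.
(* The value [- expR 20] forces [l >= 20]. With 200 the rows gain [100 * m * a] per coordinate,
   against a cost of [1 + 49 * m * a]. *)
exists 200, (- expR 20); split=> //; split; first by rewrite oppr_lt0 expR_gt0.
move=> kappa alpha kappa_lt alpha_gt.
pose K := `|kappa|; pose l := ln K.
have k0 : kappa < 0 by apply: lt_trans kappa_lt _; rewrite oppr_lt0 expR_gt0.
have K0 : 0 < K by rewrite normr_gt0 lt_eqF.
have KE : K = expR l by rewrite /l lnK.
have kappaE : kappa = - expR l by rewrite -KE /K ltr0_norm// opprK.
have l20 : 20 <= l by rewrite -ler_expR -KE /K ltr0_norm// lerNr ltW.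
have l0 : 0 < l by lra.
pose delta := 16 * l / expR l ^+ 2.
pose m := (Num.truncn (expR l ^+ 2 / l ^+ 2)).+1.
pose a := l ^+ 2 / expR l ^+ 2.
have d0 : 0 < delta := delta_gt0 l20.
have d1 : delta <= 1 / 10 := delta_small l20.
have a0 : 0 < a by rewrite divr_gt0 ?exprn_gt0 ?expR_gt0.
have Phi0 := Phi_gt0 l20 kappaE.
have mPhi : m%:R * Phi kappa <= 1 / 2 := tuple_size_Phi l20 kappaE.
pose alpha' := 200 * a / Phi kappa.
have alpha'E : 200 * ln `|kappa| ^+ 2 / (kappa ^+ 2 * Phi kappa) = alpha'.
  rewrite -/K -/l /alpha' /a kappaE sqrrN; field.
  by rewrite !gt_eqF ?expR_gt0// -kappaE.
rewrite alpha'E in alpha_gt.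
have alpha'0 : 0 < alpha' by rewrite divr_gt0// mulr_gt0.
exists delta, (1 - delta), a, m.
do 4 (split; first by lra).
split=> // M MN.
(* Eventually [M <= (alpha + 1) * N], and each row costs at most a factor [e] in the lower bound. *)
exists 1, (alpha + 1); split=> //; split; first by lra.
near=> N => I I0 I01 cardI d T P X iidX.
have N_gt0 : (0 < N)%N by near: N; exact: nbhs_infty_gt.
have N0 : 0 < N%:R :> R by rewrite ltr0n.
have M_ge : alpha' * N%:R <= (M N)%:R.
  rewrite -ler_pdivlMr//; apply: ltW; near: N.
  exact: (cvgr_gt alpha MN).
have M_le : (M N)%:R <= (alpha + 1) * N%:R.
  rewrite -ler_pdivrMr//; apply: ltW; near: N.
  by apply: (cvgr_lt alpha MN); rewrite ltrDl.
have N_big : 8 / delta <= N%:R by near: N; exact: nbhs_infty_ger.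
have dN8 : 8 <= delta * N%:R by rewrite mulrC -ler_pdivrMr.
rewrite -/(has_solution X kappa (1 - delta) delta I).
have mS := measurable_has_solution X kappa (1 - delta) delta I.
rewrite -[P _]fineK ?fin_num_measure// !lee_fin; apply/andP; split.
  (* The overlap [1 - 4 * k / N] must lie strictly between [1 - 2 * delta] and [1 - delta], so
     [4 * k] aims at the middle, [3 / 2 * delta * N]. Rounding moves it by less than 4, which
     [8 <= delta * N] absorbs. *)
  pose k := Num.truncn (3 / 8 * (delta * N%:R)).
  have k_le : k%:R <= 3 / 8 * (delta * N%:R) by rewrite truncn_le mulr_ge0//; lra.
  have k_gt : 3 / 8 * (delta * N%:R) - 1 < k%:R by rewrite ltrBlDr natr1 truncnS_gt.
  have mk : (m * k <= N)%N.
    rewrite -(ler_nat R) natrM; have : m%:R * delta <= 2 := tuple_size_delta l20.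
    have : 0 <= m%:R :> R by [].
    nra.
  have [t tI] := fset0Pn _ I0.
  apply: le_trans (has_solution_ge iidX N_gt0
    (theta := fun i : 'I_m => block_sign N k i) tI _ _ _).
  - apply: (@le_trans _ _ (expR (- 1) ^+ M N)).
      by rewrite -expRM_natl ler_expR mulrN1 lerN2.
    rewrite lerXn2r ?nnegrE ?expR_ge0//; first by lra.
    apply: (@le_trans _ _ (1 / 2)); last by lra.
    rewrite expRN div1r lef_pV2 ?posrE ?expR_gt0//.
    by apply: le_trans (expR_ge1Dx _); lra.
  - by move=> i; exact: block_sign_sign.
  - move=> i j ij; rewrite inner_block_sign//; last first.
      by apply: leq_trans mk; rewrite leq_mul2r ltn_ord orbT.
    rewrite ![_^-1 * _]mulrC ltr_pdivlMr// ltr_pdivrMr//.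
    by apply/andP; split; lra.
  - by lra.
apply: le_trans (has_solution_le iidX N_gt0 (ltW k0) I01 (i0 := ord0) (c := a)
  (delta := delta) _ _ _ _ _ _ _) _ => //; try lra.
rewrite ler_expR mul1r.
have ent : delta - delta * ln delta <= 48 * a := entropy_le l20.
have pair_le := tuple_size_pair l20 kappaE.
have ma : 1 <= m%:R * a := tuple_size_ge l20.
have m0 : 0 < m%:R :> R by rewrite ltr0n.
(* Pairs take away at most half of [m * Phi kappa], and [alpha'] times the remaining half is exactly
   [100 * m * a]. *)
have gain : 100 * (m%:R * a) * N%:R <=
    (M N)%:R * (m%:R * Phi kappa -
      m%:R ^+ 2 * expR (- (kappa ^+ 2 / (1 + (1 - delta))))).
  apply: (@le_trans _ _ (alpha' * N%:R * (m%:R * (Phi kappa / 2)))).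
    rewrite /alpha' le_eqVlt; apply/orP; left; apply/eqP; field.
    by rewrite gt_eqF.
  have a'N : 0 <= alpha' * N%:R by rewrite ltW// mulr_gt0.
  have mPhi2 : 0 <= m%:R * (Phi kappa / 2) by rewrite ltW// mulr_gt0// divr_gt0.
  apply: ler_pM => //.
  rewrite expr2 -mulrA -mulrBr ler_pM2l//.
  by rewrite lerBrDr -lerBrDl; apply: le_trans pair_le _; lra.
have entm : m%:R * (delta - delta * ln delta) <= 48 * (m%:R * a).
  by rewrite mulrCA ler_pM2l.
set ent0 := m%:R * (delta - _) in entm *.
(* Entropy contributes 48 and the angles 1; since [1 <= m * a], the gain leaves an exponent below
   [- N]. *)
have : N%:R * (1 + ent0) + m%:R * (a * N%:R) <= N%:R * (1 + 49 * (m%:R * a)).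
  have -> : m%:R * (a * N%:R) = N%:R * (m%:R * a) by ring.
  rewrite -mulrDr ler_pM2l//; lra.
nra.
Unshelve. all: by end_near.
Qed.
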